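(* Let $\delta:\mathbb{R}\to\mathbb{R}$ be a smooth function satisfying: $\delta$ is even and 1-periodic; the first derivative $\delta'$ vanishes (modulo 1) only at $0$ and $1/2$; the second derivative $\delta''$ is monotone in $(0,1/2)$; and $\delta''(0)<0$, $\delta''(1/2)>0$. For a ring of $n$ cells consider $$h(\theta)=\sum_{i=1}^n\delta(\theta_i-\theta_{i-1}),\qquad \theta_0=\theta_n,\ \theta=(\theta_1,\dots,\theta_n),$$ and the gradient system $\dot\theta=-\nabla h(\theta)$. If $n$ is even, then the ground state $(\theta_1,\dots,\theta_n)$ is given by $\theta_{i+1}-\theta_i=\tfrac12$, $i=1,\dots,n$. If $n$ is odd and sufficiently large, then the ground state is given by $\theta_{i+1}-\theta_i=\tfrac12-\tfrac1{2n}$, $i=1,\dots,n$.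
   Context: Here the phases $\theta_i$ lie in $\mathbf{S}^1\equiv\mathbb{R}/\mathbb{Z}$, $\theta_{n+1}=\theta_1$, $n\ge 3$, and differences $\theta_{i+1}-\theta_i$ are understood modulo 1. The ground state is the global minimum of $h$ on $(\mathbf{S}^1)^n$. The group $\mathbf{D}_n\times\mathbf{S}^1$ acts by $(\pi,\varphi)\cdot(\theta_1,\dots,\theta_n)=(\theta_{\pi^{-1}(1)}+\varphi,\dots,\theta_{\pi^{-1}(n)}+\varphi)$ ($\mathbf{D}_n$ being the dihedral group of permutations preserving the ring) and leaves $h$ invariant; critical points, in particular the ground state, are described up to this action. ''Sufficiently large'' means larger than some bound depending on $\delta$. *)

(* Defs.v *)
From HB Require Import structures.
From mathcomp Require Import all_boot all_order all_algebra all_fingroup.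
From mathcomp Require Import generic_quotient ring_quotient.
From mathcomp Require Import all_classical all_reals all_analysis.

Set Implicit Arguments.
Unset Strict Implicit.
Unset Printing Implicit Defensive.

Import Order.TTheory GRing.Theory Num.Theory.
Import numFieldNormedType.Exports.

Local Open Scope classical_set_scope.
Local Open Scope ring_scope.
Local Open Scope quotient_scope.

(* The subgroup Z of R: int_num_subdef is the raw predicate behind Num.int,
   and the one that carries the closure instances. *)
Definition integers (R : realType) : zmodClosed R :=
  (Num.int_num_subdef : {pred R}).

(* The circle S^1. *)
Definition circle (R : realType) : zmodType := Quotient.quot (integers R).

Definition to_circle (R : realType) (x : R) : circle R :=
  \pi_(Quotient.quot (integers R)) x.

Lemma to_circle_eq (R : realType) (x y : R) :
  (to_circle x == to_circle y) = (x - y \is a Num.int).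
Proof. by rewrite /to_circle -Quotient.idealrBE. Qed.

Lemma to_circleD (R : realType) (x y : R) :
  to_circle (x + y) = to_circle x + to_circle y.
Proof. exact: Quotient.pi_add. Qed.

(* The function induced on S^1 by a 1-periodic function on R; for such a
   function the choice of the representative is irrelevant, see
   on_circleE. *)
Definition on_circle (R : realType) (delta : R -> R) (t : circle R) : R :=
  delta (repr (t : Quotient.quot (integers R))).

Lemma on_circleE (R : realType) (delta : R -> R) (x : R) :
  periodic delta 1 -> on_circle delta (to_circle x) = delta x.
Proof.
move=> per.
have pern (k : nat) y : delta (y + k%:R) = delta y.
  elim: k y => [|k IH] y; first by rewrite addr0.
  by rewrite -natr1 addrA per IH.
have perz (k : int) y : delta (y + k%:~R) = delta y.
  case: k => k; first exact: pern.
  by rewrite NegzE mulrNz -(pern k.+1) subrK.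
rewrite /on_circle; set y := repr _.
have : to_circle y == to_circle x by rewrite /to_circle reprK.
rewrite to_circle_eq => /intrP[k xy].
by rewrite -(perz k x) -xy addrC subrK.
Qed.

(* ord_pred and ordS are the predecessor and the successor in 'I_n, taken
   cyclically: cell 0 is the successor of cell n - 1. *)
Definition ring_energy (R : realType) (delta : R -> R) (n : nat)
    (theta : {ffun 'I_n -> circle R}) : R :=
  \sum_(i < n) on_circle delta (theta i - theta (ord_pred i)).

Definition ground_state (R : realType) (delta : R -> R) (n : nat)
    (theta : {ffun 'I_n -> circle R}) : Prop :=
  forall eta : {ffun 'I_n -> circle R},
    ring_energy delta theta <= ring_energy delta eta.

Definition ring_adj (n : nat) (i j : 'I_n) : bool :=
  (j == ordS i) || (i == ordS j).

(* The automorphism group of the n-cycle, which for n >= 3 is the dihedral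
   group of order 2n. *)
Definition dihedral_perms (n : nat) : {set 'S_n} :=
  [set s : 'S_n | [forall i, forall j, ring_adj (s i) (s j) == ring_adj i j]].

Lemma dihedral_perms_group (n : nat) : group_set (dihedral_perms n).
Proof.
apply/group_setP; split=> [|s t].
  by rewrite inE; apply/forallP => i; apply/forallP => j; rewrite !perm1.
rewrite !inE => /forallP sP /forallP tP.
apply/forallP => i; apply/forallP => j; rewrite !permM.
by rewrite (eqP (forallP (tP _) _)) (eqP (forallP (sP _) _)).
Qed.

Canonical dihedral_perms_groupType (n : nat) : {group 'S_n} :=
  Group (dihedral_perms_group n).

Definition phase_act (R : realType) (n : nat) (s : 'S_n) (phi : circle R)
    (theta : {ffun 'I_n -> circle R}) : {ffun 'I_n -> circle R} :=
  [ffun i => theta ((s^-1)%g i) + phi].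

(* Up to the action of D_n x S^1, the ground state is the configuration whose
   successive phase differences are all c: such a configuration exists and
   its orbit is exactly the set of global minimizers. *)
Definition ground_state_given_by (R : realType) (delta : R -> R) (n : nat)
    (c : circle R) : Prop :=
  exists theta : {ffun 'I_n -> circle R},
    (forall i : 'I_n, theta (ordS i) - theta i = c) /\
    (forall eta : {ffun 'I_n -> circle R},
       ground_state delta eta <->
       exists (s : 'S_n) (phi : circle R),
         s \in dihedral_perms n /\ eta = phase_act s phi theta).

(* Main.v *)
Require Import Defs.
From mathcomp Require Import all_boot all_order all_algebra all_fingroup.
From mathcomp Require Import all_classical all_reals all_analysis.
From mathcomp Require Import generic_quotient.
From mathcomp Require Import ring lra zify.

Import Order.TTheory GRing.Theory Num.Theory.
Import numFieldNormedType.Exports.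

Local Open Scope classical_set_scope.
Local Open Scope ring_scope.

(** Write the step from cell [i - 1] to cell [i] as [1/2 + x_i] with
    [|x_i| <= 1/2], and let [g y = delta (1/2 + y)], which is even.  The energy
    is then the sum of the [g |x_i|].  The steps add up to [0] on the circle,
    so when [n] is odd the sum of the [x_i] is a half-integer, and in particular
    has absolute value at least [1/2] ([sum_offset_odd]); when [n] is even all
    the [x_i] may vanish.

    The problem is thus to share a total of at least [n * t] between [n]
    nonnegative numbers [|x_i|] so that the sum of the [g |x_i|] is least, where
    [t = 0] for [n] even and [t = 1/(2n)] for [n] odd.  If between [0] and [1/2] the
    graph of [g] lies above a line of slope [m >= 0] that it touches only at
    [t], then summing this inequality over the cells shows that equal shares
    are optimal and that they are the only optimum; moreover all the [x_i] must
    then have the same sign, or the total would be smaller than [n * t]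
    ([equal_shares_minimize]).

    For [t = 0] a horizontal line will do, because [g] is increasing
    there: its derivative is positive just after [0], where [g'' > 0], and
    cannot change sign before [1/2] ([derive1_gt0_until_zero]).  For [t > 0] the
    line is the tangent to [g] at [t], although [g] is not convex on the whole
    interval.  Near [0] it is strictly convex, so the tangent is fine there.
    Away from [0], the values of [g] are bounded below by some [g q > g 0],
    whereas the tangent at [t] tends to the constant [g 0] as [t] tends to [0].
    This is where [n] has to be large ([tangent_below_near_minimum]).

    It remains to identify the minimizers with an orbit.  Both signs of the
    [x_i] correspond to a configuration with constant step, [c] or [- c]; a
    configuration is determined by its steps up to a common phase, and the
    reflection of the ring exchanges [c] and [- c].  Conversely a dihedral
    permutation turns each step into [c] or [- c], which have the same energy
    ([ground_state_given_by_of_bound]). *)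

(** * Monotonicity and tangent lines near a nondegenerate minimum *)

Lemma mean_value (R : realType) (f : R -> R) (x y : R) :
  (forall z, derivable f z 1) -> x < y ->
  exists2 c, x < c < y & f y - f x = derive1 f c * (y - x).
Proof.
move=> df xy.
have [||c] := @MVT R f (derive1 f) x y xy.
- by move=> z _; rewrite derive1E; apply: DeriveDef.
- by apply: derivable_within_continuous => z _; apply: df.
- by rewrite in_itv /= => cxy ->; exists c.
Qed.

Lemma derivable_continuous_at (R : realType) (f : R -> R) (x : R) :
  derivable f x 1 -> {for x, continuous f}.
Proof. by move=> /derivable1_diffP/differentiable_continuous. Qed.

Lemma increasing_of_derive1_gt0 (R : realType) (f : R -> R) (a b : R) :
  (forall z, derivable f z 1) ->
  (forall z, a < z < b -> 0 < derive1 f z) ->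
  forall x y, a <= x -> x < y -> y <= b -> f x < f y.
Proof.
move=> df f'_gt0 x y ax xy yb.
have [c /andP[xc cy] fyx] := @mean_value R f x y df xy.
rewrite -subr_gt0 fyx mulr_gt0 ?subr_gt0 //.
by apply: f'_gt0; rewrite (le_lt_trans ax xc) (lt_le_trans cy yb).
Qed.

Lemma gt0_right_of (R : realType) (f : R -> R) (a : R) :
  {for a, continuous f} -> 0 < f a ->
  exists2 e, 0 < e & forall x, a <= x <= a + e -> 0 < f x.
Proof.
move=> cf fa.
have /nbhs_ballP[e /= e0 be] : \forall x \near a, 0 < f x by exact: (cvgr_gt (f a) cf).
exists (e / 2); first by rewrite divr_gt0.
move=> x /andP[ax xe]; apply: be; rewrite /ball /= ler0_norm; lra.
Qed.

Lemma derive1_increasing_right (R : realType) (f : R -> R) (a : R) :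
  (forall z, derivable (derive1 f) z 1) ->
  {for a, continuous (derive1 (derive1 f))} ->
  0 < derive1 (derive1 f) a ->
  exists2 e, 0 < e &
    forall x y, a <= x -> x < y -> y <= a + e -> derive1 f x < derive1 f y.
Proof.
move=> df' cf'' f''a.
have [e e0 f''_gt0] := @gt0_right_of R _ a cf'' f''a.
exists e; first exact: e0.
apply: (@increasing_of_derive1_gt0 R (derive1 f) a (a + e) df').
by move=> z /andP[az ze]; apply: f''_gt0; rewrite !ltW.
Qed.

(** The derivative leaves [a] with positive values, since [f'' a > 0], so by the
    intermediate value theorem it could only become nonpositive after vanishing
    inside the interval. *)
Lemma derive1_gt0_until_zero (R : realType) (f : R -> R) (a b : R) :
  (forall z, derivable (derive1 f) z 1) ->
  {for a, continuous (derive1 (derive1 f))} ->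
  derive1 f a = 0 -> 0 < derive1 (derive1 f) a ->
  (forall z, a < z < b -> derive1 f z <> 0) ->
  forall z, a < z < b -> 0 < derive1 f z.
Proof.
move=> df' cf'' f'a f''a f'_neq0 z /andP[az zb].
have [e e0 f'_incr] := @derive1_increasing_right R f a df' cf'' f''a.
rewrite ltNge; apply/negP => f'z.
pose y := Num.min (a + e) z.
have [ay yz ye] : [/\ a < y, y <= z & y <= a + e].
  by rewrite /y lt_min !ge_min !lexx orbT az ltrDl e0.
have f'y : 0 < derive1 f y by rewrite -f'a f'_incr.
have [||w] := @IVT R (derive1 f) y z 0 yz.
- by apply: derivable_within_continuous => w _; apply: df'.
- by rewrite ge_min le_max f'z (ltW f'y) orbT.
rewrite in_itv /= => /andP[yw wz].
by apply: f'_neq0; rewrite (lt_le_trans ay yw) (le_lt_trans wz zb).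
Qed.

(** Split the interval at a point [q] up to which [f'] is increasing.  Before [q] the mean value theorem compares the
    slope of the chord from [s] with [f' s].  Beyond [q], [f] is at least
    [f q > f a], while the tangent at [s] is at most [f s + f' s * (b - a)],
    which is close to [f a] when [s] is close to [a]. *)
Lemma tangent_below_near_minimum (R : realType) (f : R -> R) (a b : R) :
  a < b ->
  (forall z, derivable f z 1) -> (forall z, derivable (derive1 f) z 1) ->
  {for a, continuous (derive1 (derive1 f))} ->
  derive1 f a = 0 -> 0 < derive1 (derive1 f) a ->
  (forall z, a < z < b -> 0 < derive1 f z) ->
  exists2 e, 0 < e & forall s y, a < s < a + e -> a <= y <= b -> y != s ->
    f s + derive1 f s * (y - s) < f y.
Proof.
move=> ab df df' cf'' f'a f''a f'_gt0.
have [r r0 f'_incr] := @derive1_increasing_right R f a df' cf'' f''a.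
have f_incr := @increasing_of_derive1_gt0 R f a b df f'_gt0.
pose q := Num.min (a + r) b.
have [aq qb qr] : [/\ a < q, q <= b & q <= a + r].
  by rewrite /q lt_min !ge_min !lexx orbT ab ltrDl r0.
pose tangent_bound s := f s + derive1 f s * (b - a).
have tb_cont : tangent_bound s @[s --> a] --> tangent_bound a.
  have cf := @derivable_continuous_at R f a (df a).
  have cf' := @derivable_continuous_at R (derive1 f) a (df' a).
  exact: (cvgD cf (cvgM cf' (cvg_cst (b - a)))).
have tb_a : tangent_bound a < f q.
  by rewrite /tangent_bound f'a mul0r addr0 f_incr.
have /nbhs_ballP[e /= e0 be] : \forall s \near a, tangent_bound s < f q.
  by exact: (cvgr_lt (tangent_bound a) tb_cont).
exists (Num.min e (q - a)); first by rewrite lt_min e0 subr_gt0.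
move=> s y /andP[lt_as]; rewrite -ltrBlDl lt_min => /andP[se sq] /andP[ay yb] ys.
have {}sq : s < q by lra.
have [yq|qy] := leP y q.
  have [sy|{}ys|/eqP] := ltgtP s y; last by rewrite eq_sym (negbTE ys).
    have [c /andP[sc cy] fys] := @mean_value R f s y df sy.
    rewrite -ltrBrDl fys ltr_pM2r ?subr_gt0 //; apply: f'_incr; lra.
  have [c /andP[yc cs] fsy] := @mean_value R f y s df ys.
  have : derive1 f c < derive1 f s by apply: f'_incr; lra.
  by rewrite -(ltr_pM2r (_ : 0 < s - y)) ?subr_gt0 // -fsy; lra.
have f's : 0 < derive1 f s by apply: f'_gt0; lra.
have : tangent_bound s < f q.
  by apply: be; rewrite /ball /= ler0_norm; lra.
rewrite /tangent_bound => lt_fq.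
have : f q < f y by apply: f_incr; lra.
have : derive1 f s * (y - s) <= derive1 f s * (b - a).
  by rewrite ler_pM2l //; lra.
lra.
Qed.

(** * Sharing a total in equal parts *)

Lemma eq_sum_of_le (R : realType) (I : finType) (u v : I -> R) :
  (forall i, u i <= v i) -> \sum_i v i <= \sum_i u i -> forall i, u i = v i.
Proof.
move=> uv le_sum i.
have /psumr_eq0P : \sum_i (v i - u i) = 0.
  apply/le_anti; rewrite sumrB subr_le0 le_sum /=.
  by rewrite subr_ge0; apply: ler_sum.
by move=> /(_ (fun i _ => _))/(_ i isT) vu; apply/esym/subr0_eq/vu => j; rewrite subr_ge0.
Qed.

(** Summing the tangent inequality over the entries makes the slope [m] multiply
    the sum of the [|x i| - t], which the constraint makes nonnegative.  In the
    case of equality every [|x i|] is [t], so [|sum x|] reaches the sum of the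
    [|x i|], and this forces the entries to have a common sign. *)
Lemma equal_shares_minimize (R : realType) (n : nat) (g : R -> R) (m t l : R)
    (x : 'I_n -> R) :
  0 <= m ->
  (forall y, 0 <= y <= l -> y != t -> g t + m * (y - t) < g y) ->
  (forall i, `|x i| <= l) -> n%:R * t <= `|\sum_i x i| ->
  n%:R * g t <= \sum_i g `|x i| /\
  (\sum_i g `|x i| <= n%:R * g t ->
     (forall i, x i = t) \/ (forall i, x i = - t)).
Proof.
move=> m_ge0 tangent xl sum_ge.
have nM (z : R) : n%:R * z = \sum_(i < n) z.
  by rewrite sumr_const card_ord mulr_natl.
have le_abs : `|\sum_i x i| <= \sum_i `|x i| by apply: ler_norm_sum.
have le_g i : g t + m * (`|x i| - t) <= g `|x i|.
  have [->|xt] := eqVneq `|x i| t; first by rewrite subrr mulr0 addr0.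
  by rewrite ltW // tangent // normr_ge0 xl.
have sum_tan : n%:R * g t <= \sum_i (g t + m * (`|x i| - t)).
  rewrite big_split /= -mulr_sumr sumrB -!nM lerDl mulr_ge0 // subr_ge0.
  exact: le_trans le_abs.
split; first by apply: le_trans sum_tan _; apply: ler_sum.
move=> sum_le.
have eq_g := @eq_sum_of_le _ _ _ _ le_g (le_trans sum_le sum_tan).
have abs_t i : `|x i| = t.
  apply/eqP; apply: contraT => xt.
  by have := tangent `|x i|; rewrite normr_ge0 xl eq_g ltxx => /(_ isT xt).
have sum_abs : \sum_i `|x i| <= `|\sum_i x i|.
  by apply: le_trans sum_ge; rewrite nM; apply: ler_sum => i _; rewrite abs_t.
have [s_ge0|s_lt0] := leP 0 (\sum_i x i); [left|right] => i.
  rewrite ger0_norm // in sum_abs.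
  rewrite -(abs_t i).
  by apply: (@eq_sum_of_le _ _ x (fun i => `|x i|)) => // j; apply: ler_norm.
rewrite ltr0_norm // -sumrN in sum_abs.
rewrite -(abs_t i); apply/oppr_inj; rewrite opprK.
apply: (@eq_sum_of_le _ _ (fun i => - x i) (fun i => `|x i|)) => // j.
by rewrite -normrN ler_norm.
Qed.

(** * The circle *)

Lemma to_circle_eq0 (R : realType) (x : R) :
  (to_circle x == 0) = (x \is a Num.int).
Proof.
have -> : 0 = to_circle (0 : R).
  by apply: (@addrI _ (to_circle (0 : R))); rewrite -to_circleD !addr0.
by rewrite to_circle_eq subr0.
Qed.

Lemma to_circle_int (R : realType) (x : R) : x \is a Num.int -> to_circle x = 0.
Proof. by rewrite -to_circle_eq0 => /eqP. Qed.

Lemma to_circleN (R : realType) (x : R) : to_circle (- x) = - to_circle x.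
Proof.
by apply/eqP; rewrite -subr_eq0 opprK -to_circleD addNr to_circle_eq0 rpred0.
Qed.

Lemma to_circleMn (R : realType) (x : R) (n : nat) :
  to_circle (x *+ n) = to_circle x *+ n.
Proof.
elim: n => [|n IH]; first by rewrite !mulr0n to_circle_int ?rpred0.
by rewrite !mulrS to_circleD IH.
Qed.

Lemma to_circle_sum (R : realType) (I : finType) (x : I -> R) :
  to_circle (\sum_i x i) = \sum_i to_circle (x i).
Proof.
apply: (big_morph _ (@to_circleD R)).
by rewrite to_circle_int ?rpred0.
Qed.

Lemma to_circle_half_opp (R : realType) (x : R) :
  - to_circle (1 / 2 - x) = to_circle (1 / 2 + x).
Proof.
rewrite -to_circleN; apply/eqP; rewrite to_circle_eq.
by rewrite (_ : _ - _ = -1) ?rpredN1 //; field.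
Qed.

Lemma circle_between_half_and_one (R : realType) (z : R) : 1 / 2 < z < 1 ->
  ~ (to_circle z = to_circle 0 \/ to_circle z = to_circle (1 / 2)).
Proof.
move=> /andP[z_gt z_lt].
have no_int (k : int) : 0 < k%:~R :> R -> k%:~R < 1 :> R -> False.
  by rewrite ltrz1 ltr0z; lia.
by case=> /eqP; rewrite to_circle_eq => /intrP[k zk]; apply: (no_int k); lra.
Qed.

(** The position of [u] relative to the antipodal point [1/2], taken in
    the half-open interval from [- 1/2] to [1/2]. *)
Definition offset (R : realType) (u : circle R) : R :=
  let x : R := repr (u : Quotient.quot (integers R)) in
  x - (Num.floor x)%:~R - 1 / 2.

Lemma offset_le_half (R : realType) (u : circle R) : `|offset R u| <= 1 / 2.
Proof.
rewrite /offset; set x := repr _.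
have /andP[] := floor_itv x; rewrite intrD => fx xf.
by rewrite ler_norml; apply/andP; split; lra.
Qed.

Lemma offsetK (R : realType) (u : circle R) : to_circle (1 / 2 + offset R u) = u.
Proof.
rewrite /offset; set x := repr _.
have <- : to_circle x = u by rewrite /to_circle reprK.
apply/eqP; rewrite to_circle_eq.
have -> : 1 / 2 + (x - (Num.floor x)%:~R - 1 / 2) - x = - (Num.floor x)%:~R :> R.
  by ring.
by rewrite rpredN intr_int.
Qed.

(** Each of the [n] halves contributes [1/2] to the sum of the lifts
    [1/2 + offset], which is an integer; for [n] odd, the offsets therefore add
    up to a half-integer. *)
Lemma sum_offset_odd (R : realType) (n : nat) (u : 'I_n -> circle R) :
  odd n -> \sum_i u i = 0 -> 1 / 2 <= `|\sum_i offset R (u i)|.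
Proof.
move=> n_odd sum0; set S := \sum_i _.
have /intrP[z] : \sum_(i < n) (1 / 2 + offset R (u i)) \is a Num.int.
  rewrite -to_circle_eq0 to_circle_sum (eq_bigr u) ?sum0 // => i _.
  by rewrite offsetK.
rewrite big_split /= sumr_const card_ord -/S -[_ *+ n]mulr_natr.
rewrite -[in n%:R](odd_double_half n) n_odd -muln2 natrD natrM /= => Sz.
have {Sz} -> : S = (z - n./2%:Z)%:~R - 1 / 2.
  by rewrite intrB -pmulrn -Sz; field.
(* An integer minus 1/2 is at most - 1/2 or at least 1/2. *)
have [w_le0|w_gt0] := leP (z - n./2%:Z) 0.
  have : (z - n./2%:Z)%:~R <= 0 :> R by rewrite lerz0.
  by move=> ?; rewrite ler0_norm; lra.
have : 1 <= (z - n./2%:Z)%:~R :> R by rewrite ler1z; lia.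
by move=> ?; rewrite ger0_norm; lra.
Qed.

(** * Configurations on the ring *)

Lemma sum_steps (V : zmodType) (n : nat) (theta : 'I_n -> V) :
  \sum_i (theta i - theta (ord_pred i)) = 0.
Proof.
rewrite sumrB [X in _ - X](_ : _ = \sum_i theta i) ?subrr //.
by rewrite [RHS](reindex_inj (@ord_pred_inj n)).
Qed.

Lemma step_constE (V : zmodType) (n : nat) (theta : 'I_n -> V) (c : V) :
  (forall i, theta (ordS i) - theta i = c) <->
  (forall i, theta i - theta (ord_pred i) = c).
Proof.
split=> h i; first by rewrite -{1}(ord_predK i).
by rewrite -{2}(ordSK i).
Qed.

Lemma equal_steps_unique (V : zmodType) (n : nat) (theta eta : 'I_n -> V) (c : V) :
  (forall i, theta (ordS i) - theta i = c) ->
  (forall i, eta (ordS i) - eta i = c) ->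
  exists phi, forall i, eta i = theta i + phi.
Proof.
case: n theta eta => [|n] theta eta theta_c eta_c; first by exists 0 => -[].
exists (eta ord0 - theta ord0) => -[i i_lt].
elim: i i_lt => [|i IH] i_lt.
  by rewrite (_ : Ordinal i_lt = ord0) ?subrKC //; apply: val_inj.
have i_lt' := ltnW i_lt.
have -> : Ordinal i_lt = ordS (Ordinal i_lt').
  by apply: val_inj; rewrite /= modn_small.
have /eqP := eta_c (Ordinal i_lt'); rewrite subr_eq => /eqP ->.
have /eqP := theta_c (Ordinal i_lt'); rewrite subr_eq => /eqP ->.
by rewrite IH addrA.
Qed.

(** The condition [c *+ n = 0] is what makes the step from cell [n - 1] back to
    cell [0] equal to [c] as well. *)
Lemma equal_steps_exist (V : zmodType) (n : nat) (c : V) :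
  c *+ n = 0 ->
  forall i : 'I_n, c *+ (ordS i : nat) - c *+ i = c.
Proof.
move=> cn0 i /=; have := ltn_ord i; rewrite leq_eqVlt => /predU1P[i_last|lt_in].
  rewrite i_last modnn mulr0n sub0r; apply/eqP.
  by rewrite eq_sym -addr_eq0 -mulrS i_last cn0.
by rewrite modn_small // mulrS addrK.
Qed.

Lemma rev_ord_ordS (n : nat) (i : 'I_n) : rev_ord (ordS i) = ord_pred (rev_ord i).
Proof.
apply: (@ordS_inj n); rewrite ord_predK; apply: val_inj => /=.
have := ltn_ord i; rewrite leq_eqVlt => /predU1P[i_last|lt_in].
  by rewrite i_last modnn subn1 prednK ?modnn ?subnn //; lia.
by rewrite (modn_small lt_in) modn_small; lia.
Qed.

Definition reflection (n : nat) : 'S_n := perm (@rev_ord_inj n).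

Lemma ring_adj_rev (n : nat) (i j : 'I_n) :
  ring_adj (rev_ord i) (rev_ord j) = ring_adj i j.
Proof.
have key (k l : 'I_n) : (rev_ord k == ordS (rev_ord l)) = (l == ordS k).
  by rewrite -(inj_eq (@ord_pred_inj n)) ordSK -rev_ord_ordS (inj_eq rev_ord_inj) eq_sym.
by rewrite /ring_adj !key orbC.
Qed.

Lemma reflection_dihedral (n : nat) : reflection n \in dihedral_perms n.
Proof.
rewrite inE; apply/forallP => i; apply/forallP => j.
by rewrite !permE ring_adj_rev.
Qed.

Lemma dihedral_permV (n : nat) (s : 'S_n) (i : 'I_n) :
  s \in dihedral_perms n ->
  (s^-1)%g (ordS i) = ordS ((s^-1)%g i) \/ (s^-1)%g i = ordS ((s^-1)%g (ordS i)).
Proof.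
rewrite -groupV inE => /forallP/(_ i)/forallP/(_ (ordS i)) => /eqP.
by rewrite {2}/ring_adj eqxx /= => /orP[] /eqP; [left|right].
Qed.

(** A dihedral permutation maps neighbours to neighbours, but may reverse the
    direction in which the ring is traversed. *)
Lemma phase_act_steps (R : realType) (n : nat) (s : 'S_n) (phi c : circle R)
    (theta : {ffun 'I_n -> circle R}) :
  s \in dihedral_perms n ->
  (forall i, theta (ordS i) - theta i = c) ->
  forall i, phase_act s phi theta (ordS i) - phase_act s phi theta i = c \/
            phase_act s phi theta (ordS i) - phase_act s phi theta i = - c.
Proof.
move=> sD theta_c i; rewrite !ffunE opprD addrACA subrr addr0.
have [->|->] := dihedral_permV n s i sD; [left|right]; first exact: theta_c.
by rewrite -opprB theta_c.
Qed.

(** Reduces the description of the whole orbit of minimizers to a sharp lower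
    bound of the energy whose equality cases are the constant steps [c] and
    [- c]; the configuration [i |-> c *+ i] is the representative. *)
Lemma ground_state_given_by_of_bound (R : realType) (delta : R -> R) (n : nat)
    (c : circle R) :
  c *+ n = 0 ->
  on_circle delta (- c) = on_circle delta c ->
  (forall eta : {ffun 'I_n -> circle R},
     n%:R * on_circle delta c <= ring_energy delta eta /\
     (ring_energy delta eta <= n%:R * on_circle delta c ->
        (forall i, eta i - eta (ord_pred i) = c) \/
        (forall i, eta i - eta (ord_pred i) = - c))) ->
  ground_state_given_by delta n c.
Proof.
move=> cn0 deltaN bound.
pose theta : {ffun 'I_n -> circle R} := [ffun i : 'I_n => c *+ i].
have theta_c i : theta (ordS i) - theta i = c.
  by rewrite !ffunE equal_steps_exist.
have energy_pm (eta : {ffun 'I_n -> circle R}) :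
    (forall i, eta (ordS i) - eta i = c \/ eta (ordS i) - eta i = - c) ->
    ring_energy delta eta = n%:R * on_circle delta c.
  move=> eta_c; rewrite mulr_natl -{2}(card_ord n) -sumr_const.
  apply: eq_bigr => i _; have := eta_c (ord_pred i).
  by rewrite ord_predK => -[->|->].
exists theta; split=> // eta; split=> [eta_min|[s [phi [sD ->]]]].
  have [_] := bound eta; case.
  - by apply: le_trans (eta_min theta) _; rewrite energy_pm // => i; left.
  - move=> /step_constE eta_c.
    have [phi eta_phi] := equal_steps_unique _ _ _ _ _ theta_c eta_c.
    exists 1%g, phi; split; first exact: group1.
    by apply/ffunP => i; rewrite ffunE invg1 perm1.
  - move=> /step_constE eta_c.
    have theta_rev_c i : theta (rev_ord (ordS i)) - theta (rev_ord i) = - c.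
      rewrite rev_ord_ordS -opprB; congr (- _).
      exact: (iffLR (step_constE _ _ theta c) theta_c).
    (* Read backwards, theta has steps - c, like eta. *)
    have [phi eta_phi] := equal_steps_unique _ _ (theta \o @rev_ord n) _ _ theta_rev_c eta_c.
    exists (reflection n)^-1%g, phi; split.
      by rewrite groupV reflection_dihedral.
    by apply/ffunP => i; rewrite ffunE invgK permE eta_phi.
move=> zeta; rewrite energy_pm; first by have [] := bound zeta.
exact: phase_act_steps.
Qed.

(** * Ground states *)

(** Covers both parities at once: [t = 0] and [m = 0] for even rings, [t = 1/(2n)]
    and the slope of the tangent at [1/2 + t] for odd ones. *)
Lemma equal_shares_ground_state (R : realType) (delta : R -> R) (n : nat) (m t : R) :
  periodic delta 1 -> (forall x, delta (- x) = delta x) ->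
  to_circle (1 / 2 - t) *+ n = 0 ->
  (forall u : 'I_n -> circle R, \sum_i u i = 0 ->
     n%:R * t <= `|\sum_i offset R (u i)|) ->
  0 <= m ->
  (forall y, 0 <= y <= 1 / 2 -> y != t ->
     delta (1 / 2 + t) + m * (y - t) < delta (1 / 2 + y)) ->
  ground_state_given_by delta n (to_circle (1 / 2 - t)).
Proof.
move=> per even cn0 sum_offset m_ge0 tangent.
have half_opp x : delta (1 / 2 - x) = delta (1 / 2 + x).
  by rewrite -even -(per (- _)); congr delta; field.
have delta_abs x : delta (1 / 2 + `|x|) = delta (1 / 2 + x).
  by have [x0|x0] := ger0P x; rewrite ?half_opp.
have delta_c : on_circle delta (to_circle (1 / 2 - t)) = delta (1 / 2 + t).
  by rewrite on_circleE.
apply: ground_state_given_by_of_bound => // [|eta].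
  by rewrite to_circle_half_opp on_circleE // delta_c.
pose u i := eta i - eta (ord_pred i).
have u_sum : \sum_i u i = 0 by apply: sum_steps.
have -> : ring_energy delta eta = \sum_i delta (1 / 2 + `|offset R (u i)|).
  apply: eq_bigr => i _; rewrite delta_abs -(on_circleE _ per) offsetK //.
rewrite delta_c.
have [bound bound_eq] := equal_shares_minimize R n (fun y => delta (1 / 2 + y))
  m t (1 / 2) (fun i => offset R (u i)) m_ge0 tangent
  (fun i => offset_le_half R (u i)) (sum_offset u u_sum).
split=> // /bound_eq[] off; [right|left] => i; rewrite -/(u i) -(offsetK R (u i)) off //.
by rewrite to_circle_half_opp.
Qed.

Lemma ground_state_even (R : realType) (delta : R -> R) (n : nat) :
  periodic delta 1 -> (forall x, delta (- x) = delta x) ->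
  (forall x y, 1 / 2 <= x -> x < y -> y <= 1 -> delta x < delta y) ->
  ~~ odd n -> ground_state_given_by delta n (to_circle (1 / 2)).
Proof.
move=> per even incr n_even.
(* The line is the horizontal one through the minimum. *)
rewrite -[1 / 2]subr0.
apply: (equal_shares_ground_state R delta n 0 0) => // [|u u0|y /andP[y0 y_le] y_neq0].
- rewrite subr0 -to_circleMn to_circle_int // -(even_halfK n_even) -muln2 mulnC mulrnA.
  by rewrite -(_ : 1 = 1 / 2 *+ 2 :> R) ?rpred_nat // -mulr_natr; field.
- by rewrite mulr0 normr_ge0.
have y_gt0 : 0 < y by rewrite lt_neqAle eq_sym y_neq0.
by rewrite mul0r !addr0; apply: incr; lra.
Qed.

Lemma ground_state_odd (R : realType) (delta : R -> R) (n : nat) (t : R) :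
  periodic delta 1 -> (forall x, delta (- x) = delta x) ->
  t = 1 / (2 * n%:R) ->
  0 <= derive1 delta (1 / 2 + t) ->
  (forall y, 1 / 2 <= y <= 1 -> y != 1 / 2 + t ->
    delta (1 / 2 + t) + derive1 delta (1 / 2 + t) * (y - (1 / 2 + t)) < delta y) ->
  odd n -> ground_state_given_by delta n (to_circle (1 / 2 - t)).
Proof.
move=> per even tE slope_ge0 tangent n_odd.
have n_gt0 : 0 < n%:R :> R by rewrite ltr0n odd_gt0.
have nt : n%:R * t = 1 / 2 by rewrite tE; field; rewrite gt_eqF.
apply: (equal_shares_ground_state R delta n (derive1 delta (1 / 2 + t)) t) => //.
- rewrite -to_circleMn to_circle_int // mulrnBl -[t *+ n]mulr_natl nt.
  rewrite -(odd_double_half n) n_odd mulrS addrAC subrr add0r -muln2 mulnC mulrnA.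
  by rewrite -(_ : 1 = 1 / 2 *+ 2 :> R) ?rpred_nat // -mulr_natr; field.
- by move=> u u0; rewrite nt; apply: sum_offset_odd.
move=> y /andP[y0 y_le] y_t.
have -> : y - t = (1 / 2 + y) - (1 / 2 + t) by ring.
apply: tangent; first by clear - y0 y_le; lra.
by apply: contra y_t => /eqP/addrI ->.
Qed.

Lemma small_shift (R : realType) (e : R) : 0 < e ->
  exists N : nat, forall n : nat, (3 <= n)%N -> (N < n)%N ->
    (0 : R) < 1 / (2 * n%:R) < Num.min e (1 / 2).
Proof.
move=> e0; exists (Num.bound e^-1) => n n_ge3 n_large.
have n3 : 3 <= n%:R :> R by rewrite ler_nat.
have n_inv : n%:R^-1 < e.
  rewrite invf_plt ?posrE //; last by lra.
  apply: lt_le_trans (archi_boundP _) _; first by rewrite invr_ge0 ltW.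
  by rewrite ler_nat ltnW.
have n_inv1 : n%:R^-1 < 1 :> R by rewrite invf_lt1; lra.
have n_inv0 : 0 < n%:R^-1 :> R by rewrite invr_gt0; lra.
rewrite lt_min (_ : 1 / (2 * n%:R) = n%:R^-1 / 2); last by field; lra.
by apply/and3P; split; lra.
Qed.

Theorem proposition4p6 (R : realType) (delta : R -> R)
  (delta_smooth : forall (k : nat) (x : R), derivable (derive1n k delta) x 1)
  (delta_even : forall x : R, delta (- x) = delta x)
  (delta_periodic : periodic delta 1)
  (delta'_zeros : forall x : R,
     derive1 delta x = 0 <->
     to_circle x = to_circle 0 \/ to_circle x = to_circle (1 / 2))
  (delta''_monotone :
     (forall x y : R, 0 < x -> x <= y -> y < 1 / 2 ->
        derive1n 2 delta x <= derive1n 2 delta y) \/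
     (forall x y : R, 0 < x -> x <= y -> y < 1 / 2 ->
        derive1n 2 delta y <= derive1n 2 delta x))
  (delta''_0 : derive1n 2 delta 0 < 0)
  (delta''_half : 0 < derive1n 2 delta (1 / 2)) :
  (forall n : nat, (3 <= n)%N -> ~~ odd n ->
     ground_state_given_by delta n (to_circle (1 / 2))) /\
  (exists N : nat, forall n : nat, (3 <= n)%N -> odd n -> (N < n)%N ->
     ground_state_given_by delta n (to_circle (1 / 2 - 1 / (2 * n%:R)))).
Proof.
have d0 := delta_smooth 0; have d1 := delta_smooth 1; rewrite /= in d0 d1.
have c2 := derivable_continuous_at R _ _ (delta_smooth 2 (1 / 2)).
have crit : derive1 delta (1 / 2) = 0 by apply/delta'_zeros; right.
have neq0 z : 1 / 2 < z < 1 -> derive1 delta z <> 0.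
  by move=> z_in /delta'_zeros; apply: circle_between_half_and_one.
have delta'_gt0 := derive1_gt0_until_zero R delta (1 / 2) 1 d1 c2 crit delta''_half neq0.
split=> [n n_ge3|].
  apply: ground_state_even => //.
  exact: (increasing_of_derive1_gt0 R delta (1 / 2) 1 d0 delta'_gt0).
have half_lt1 : 1 / 2 < 1 :> R by rewrite ltr_pdivrMr // mul1r ltr1n.
have [e e0 tangent] := tangent_below_near_minimum R delta (1 / 2) 1 half_lt1
  d0 d1 c2 crit delta''_half delta'_gt0.
have [N t_small] := small_shift R e e0.
exists N => n n_ge3 n_odd n_large.
have /andP[t0] := t_small n n_ge3 n_large; rewrite lt_min => /andP[te t_half].
apply: ground_state_odd => //.
  apply/ltW/delta'_gt0; rewrite ltrDl t0 /=.
  by rewrite [ltRHS](splitr 1) ltrD2l.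
by move=> y y_in y_t; apply: tangent; rewrite // ltrDl t0 ltrD2l.
Qed.
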